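(* Let $b,c,d\in\mathbb{C}$ and consider the general complex cubic equation $x^3+bx^2+cx+d=0$. Let $\Delta_o$, $d_o$, $\delta_l$, $A_1$, $A_2$ be the expressions in $b,c,d$ defined in the context, and let $$\mathcal{R}_1:=\sqrt[3]{\frac{\sqrt{-3}}{9}\sqrt{\Delta_o}+\frac{2b^3-9cb+27d}{27}},\qquad \mathcal{R}_2:=\sqrt[3]{\frac{\sqrt{-3}}{9}\sqrt{\Delta_o}-\frac{2b^3-9cb+27d}{27}}.$$ Then the set of solutions of $x^3+bx^2+cx+d=0$ is given by $$x_m=m\,\alpha_1\mathcal{R}_1+m^2\alpha_2\mathcal{R}_2-\frac{b}{3},\qquad m\in\left\{-1,\ \frac{1-\sqrt{-3}}{2},\ \frac{1+\sqrt{-3}}{2}\right\},$$ where $$\alpha_1:=\frac{\sqrt[3]{4}}{2}\exp\left\{\sqrt{-1}\left[\arg\left(A_1\sqrt[3]{\delta_l}\right)-\arg\left(-d_o\mathcal{R}_1\right)\right]\right\},\qquad \alpha_2:=\frac{\sqrt[3]{4}}{2}\exp\left\{\sqrt{-1}\left[\arg\left(A_2\sqrt[3]{\delta_l^2}\right)-\arg\left(d_o^2\mathcal{R}_2\right)\right]\right\}.$$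
   Context: All square and cubic roots of complex numbers are taken with the standard convention (principal roots): $\arg(\sqrt[3]{X})=\frac13\arg(X)$ and $\arg(\sqrt{X})=\frac12\arg(X)$, where $\arg$ is the principal argument. Definitions, for $b,c,d\in\mathbb{C}$: $$\begin{aligned}\Delta_l:={}&2c^3\left(8b^6+132b^3d+36d^2+c^3+33b^2c^2-66bcd\right)+12b^4c\left(d^2-7c^3\right)\\&-b^2c^2d\left(24b^3+291d\right)+d^3\left(144bc-2b^3-27d\right),\end{aligned}$$ $$\Delta_o:=-4b^3d+b^2c^2+18bcd-4c^3-27d^2,$$ $$d_o:=4b^4c^2-4b^3cd-14b^2c^3+b^2d^2+28bc^2d+c^4-12cd^2,$$ $$\delta_l:=(d-bc)\sqrt{\Delta_o}\left(4b^2c^2-4bcd+2c^3+d^2\right)+\frac{\sqrt{-3}}{9}\Delta_l,$$ $$A_1:=-\frac{2\sqrt{-3}}{3}\left(4b^3c-2db^2-13bc^2+15dc\right)+2c\sqrt{\Delta_o},$$ $$\begin{aligned}A_2:={}&8b^5c^2-8b^4cd-40b^3c^3+2b^3d^2+116b^2c^2d+23bc^4-99bcd^2-21c^3d+27d^3\\&-\sqrt{-3}\left(8b^2c^2-10bcd+c^3+3d^2\right)\sqrt{\Delta_o}.\end{aligned}$$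
   Formalization: Proved assuming d_o ≠ 0 (otherwise arg 0 appears, and the formula fails for x^3+x^2), and with the cube root of δ_l^2 in α_2 read as the square of the principal cube root of δ_l; the literal principal root fails for x^3−3x+2. *)

(* Defs.v *)
From HB Require Import structures.
From mathcomp Require Import all_boot all_order all_algebra.
From mathcomp Require Import all_classical all_reals all_analysis.
From mathcomp Require Import complex.

Set Implicit Arguments.
Unset Strict Implicit.
Unset Printing Implicit Defensive.

Import Order.TTheory GRing.Theory Num.Theory.
Import numFieldNormedType.Exports.

Local Open Scope ring_scope.
Local Open Scope complex_scope.

Definition cmod (R : realType) (z : R[i]) : R := complex.Re `|z|.

(* Principal argument, in ]-pi, pi]; the value at 0 is a convention. *)
Definition carg (R : realType) (z : R[i]) : R :=
  if z == 0 then 0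
  else if 0 <= complex.Im z then acos (complex.Re z / cmod z)
  else - acos (complex.Re z / cmod z).

Definition cexp (R : realType) (z : R[i]) : R[i] :=
  (expR (complex.Re z))%:C * (cos (complex.Im z) +i* sin (complex.Im z)).

(* Principal n-th root: arg (croot n z) = arg z / n.  Neither [sqrtC] nor     *)
(* [n.-root] is principal: they return roots of nonnegative imaginary part.   *)
Definition croot (R : realType) (n : nat) (z : R[i]) : R[i] :=
  (cmod z `^ n%:R^-1)%:C * cexp ('i%C * (carg z / n%:R)%:C).

Section CubicData.
Variables (R : realType) (b c d : R[i]).

Definition sqrtN3 : R[i] := croot 2 (-3).

Definition Delta_l : R[i] :=
  2 * c ^+ 3 * (8 * b ^+ 6 + 132 * b ^+ 3 * d + 36 * d ^+ 2 + c ^+ 3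
                + 33 * b ^+ 2 * c ^+ 2 - 66 * b * c * d)
  + 12 * b ^+ 4 * c * (d ^+ 2 - 7 * c ^+ 3)
  - b ^+ 2 * c ^+ 2 * d * (24 * b ^+ 3 + 291 * d)
  + d ^+ 3 * (144 * b * c - 2 * b ^+ 3 - 27 * d).

Definition Delta_o : R[i] :=
  - 4 * b ^+ 3 * d + b ^+ 2 * c ^+ 2 + 18 * b * c * d
  - 4 * c ^+ 3 - 27 * d ^+ 2.

(* If d_o = 0 then alpha_1 and alpha_2 involve the undefined arg 0, and the    *)
(* formula fails for any value given to arg 0: for x^3 + x^2 all of d_o, A_1, *)
(* A_2 and delta_l vanish.                                                    *)
Definition d_o : R[i] :=
  4 * b ^+ 4 * c ^+ 2 - 4 * b ^+ 3 * c * d - 14 * b ^+ 2 * c ^+ 3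
  + b ^+ 2 * d ^+ 2 + 28 * b * c ^+ 2 * d + c ^+ 4 - 12 * c * d ^+ 2.

Definition delta_l : R[i] :=
  (d - b * c) * croot 2 Delta_o
    * (4 * b ^+ 2 * c ^+ 2 - 4 * b * c * d + 2 * c ^+ 3 + d ^+ 2)
  + sqrtN3 / 9 * Delta_l.

Definition A_1 : R[i] :=
  - (2 * sqrtN3 / 3)
    * (4 * b ^+ 3 * c - 2 * d * b ^+ 2 - 13 * b * c ^+ 2 + 15 * d * c)
  + 2 * c * croot 2 Delta_o.

Definition A_2 : R[i] :=
  8 * b ^+ 5 * c ^+ 2 - 8 * b ^+ 4 * c * d - 40 * b ^+ 3 * c ^+ 3
  + 2 * b ^+ 3 * d ^+ 2 + 116 * b ^+ 2 * c ^+ 2 * d + 23 * b * c ^+ 4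
  - 99 * b * c * d ^+ 2 - 21 * c ^+ 3 * d + 27 * d ^+ 3
  - sqrtN3 * (8 * b ^+ 2 * c ^+ 2 - 10 * b * c * d + c ^+ 3 + 3 * d ^+ 2)
    * croot 2 Delta_o.

Definition R_1 : R[i] :=
  croot 3 (sqrtN3 / 9 * croot 2 Delta_o
           + (2 * b ^+ 3 - 9 * c * b + 27 * d) / 27).

Definition R_2 : R[i] :=
  croot 3 (sqrtN3 / 9 * croot 2 Delta_o
           - (2 * b ^+ 3 - 9 * c * b + 27 * d) / 27).

Definition alpha_1 : R[i] :=
  croot 3 4 / 2
  * cexp ('i%C * (carg (A_1 * croot 3 delta_l) - carg (- d_o * R_1))%:C).

(* The radical of delta_l ^ 2 denotes the principal power delta_l ^ (2/3),    *)
(* i.e. the square of the principal cube root.  It differs from               *)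
(* [croot 3 (delta_l ^+ 2)] when [2 * carg delta_l] leaves ]-pi, pi], and     *)
(* then the latter does not give the roots: for x^3 - 3 x + 2 it yields      *)
(* the non-real value 1 + i sqrt 3 at m = -1.                                 *)
Definition alpha_2 : R[i] :=
  croot 3 4 / 2
  * cexp ('i%C * (carg (A_2 * (croot 3 delta_l) ^+ 2)
                - carg (d_o ^+ 2 * R_2))%:C).

Definition cubic_sol (m : R[i]) : R[i] :=
  m * alpha_1 * R_1 + m ^+ 2 * alpha_2 * R_2 - b / 3.

End CubicData.

Arguments sqrtN3 R : clear implicits.

(* Main.v *)
Require Import Defs.
From mathcomp Require Import all_boot all_order all_algebra.
From mathcomp Require Import all_classical all_reals all_analysis.
From mathcomp Require Import complex.
From mathcomp Require Import ring.

(** The substitution x = y - b / 3 turns the cubic into y^3 + p y + q = 0 with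
    p = c - b^2 / 3 and q = (2 b^3 - 9 b c + 27 d) / 27.  If U^3 - V^3 = q and
    3 U V = p, then the numbers y = m U + m^2 V, with m ranging over the cube
    roots of -1, are the roots of the latter ([Cardano]).  It remains to see
    that U = alpha_1 R_1 and V = alpha_2 R_2 are such numbers.

    Put s = sqrt (-3) and D = sqrt Delta_o, so that R_1^3 = s D / 9 + q and
    R_2^3 = s D / 9 - q.  Only the coupling 3 U V = p is delicate, since it
    requires the cube roots U and V to be chosen compatibly; the numbers A_1,
    A_2 and delta_l are there to make this choice by rational means.  Modulo
    s^2 = -3 and D^2 = Delta_o, they satisfy the polynomial identities
      A_1^3 delta_l     = 64 (- d_o)^3 R_1^3    ([A_1_cube]),
      A_2^3 delta_l^2   = 16 d_o^6 R_2^3        ([A_2_cube]),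
      A_1 A_2 delta_l   = - (16 / 3) d_o^3 p    ([A_1_A_2]).
    Let t be the principal cube root of delta_l.  The first two identities say
    that A_1 t and - d_o R_1, and likewise A_2 t^2 and d_o^2 R_2, have cubes in
    a positive real ratio.  The difference of arguments in alpha_1 is the one
    rotation that brings - d_o R_1 onto the half-line of A_1 t
    ([rotation_to_cube_multiple]), whence with the positive constant
    k = 4^(1/3) / 2, k^3 = 1 / 2,
      alpha_1 R_1 = - k A_1 t / (4 d_o),
      alpha_2 R_2 = A_2 t^2 / (4 k d_o^2).
    The right-hand sides no longer involve arguments, and the three identities
    give their cubes and their product.  This form also covers the cases where
    R_1 or R_2 vanishes: both sides are then zero, whatever the argument of 0
    is taken to be. *)

Import Order.TTheory GRing.Theory Num.Theory.

Local Open Scope ring_scope.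
Local Open Scope complex_scope.
Local Open Scope classical_set_scope.

(** * Polar form and principal roots *)

Lemma cexp_i (R : realType) (x : R) :
  cexp ('i%C * x%:C) = cos x +i* sin x.
Proof.
rewrite /cexp /= !(mul0r, mulr0, subr0, mul1r, addr0, add0r, oppr0) expR0.
by rewrite rmorph1 mul1r.
Qed.

Lemma cexp_iD (R : realType) (x y : R) :
  cexp ('i%C * (x + y)%:C) = cexp ('i%C * x%:C) * cexp ('i%C * y%:C).
Proof.
rewrite !cexp_i cosD sinD; apply/eqP; rewrite eq_complex /=.
by rewrite eqxx addrC eqxx.
Qed.

Lemma cexp_iMn (R : realType) (x : R) (n : nat) :
  cexp ('i%C * x%:C) ^+ n = cexp ('i%C * (x *+ n)%:C).
Proof.
elim: n => [|n IHn].
  by rewrite expr0 mulr0n cexp_i cos0 sin0.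
by rewrite exprS mulrS cexp_iD IHn.
Qed.

Lemma cmodE (R : realType) (z : R[i]) : (cmod z)%:C = `|z|.
Proof. by rewrite /cmod normc_def. Qed.

Lemma cmod_ge0 (R : realType) (z : R[i]) : 0 <= cmod z.
Proof. by rewrite -lecR cmodE normr_ge0. Qed.

Lemma polar_form (R : realType) (z : R[i]) :
  z = `|z| * cexp ('i%C * (carg z)%:C).
Proof.
have [->|z0] := eqVneq z 0; first by rewrite normr0 mul0r.
have mod_gt0 : 0 < cmod z by rewrite -ltcR cmodE normr_gt0.
have modsq : complex.Re z ^+ 2 + complex.Im z ^+ 2 = cmod z ^+ 2.
  by apply: complexI; rewrite add_Re2_Im2 rmorphXn /= cmodE.
have quot : (complex.Re z / cmod z) ^+ 2 + (complex.Im z / cmod z) ^+ 2 = 1.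
  by rewrite !expr_div_n -mulrDl modsq divff// expf_neq0 ?gt_eqF.
have bnd : -1 <= complex.Re z / cmod z <= 1.
  rewrite -ler_norml -(@ler_pXn2r _ 2) ?nnegrE// expr1n real_normK ?num_real//.
  by rewrite -quot lerDl sqr_ge0.
have sin_ac : sin (acos (complex.Re z / cmod z)) = `|complex.Im z| / cmod z.
  rewrite sin_acos// -quot addrAC subrr add0r sqrtr_sqr normrM.
  by rewrite normfV (gtr0_norm mod_gt0).
have cos_arg : cos (carg z) = complex.Re z / cmod z.
  by rewrite /carg (negbTE z0); case: ifP => _; rewrite ?cosN acosK.
have sin_arg : sin (carg z) = complex.Im z / cmod z.
  rewrite /carg (negbTE z0); case: ifPn => [Im0|]; first by rewrite sin_ac ger0_norm.
  by rewrite -ltNge => Im0; rewrite sinN sin_ac ltr0_norm// mulNr opprK.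
rewrite -cmodE cexp_i cos_arg sin_arg; apply/eqP; rewrite eq_complex /=.
rewrite !mul0r subr0 addr0 ![cmod z * _]mulrC.
by rewrite !(divfK (lt0r_neq0 mod_gt0)) !eqxx.
Qed.

Lemma crootK (R : realType) (n : nat) (z : R[i]) :
  (0 < n)%N -> croot n z ^+ n = z.
Proof.
move=> n0; have n_neq0 : n%:R != 0 :> R by rewrite pnatr_eq0 -lt0n.
rewrite /croot exprMn cexp_iMn -[carg z / n%:R *+ n]mulr_natr divfK//.
rewrite -rmorphXn /= -powR_mulrn ?powR_ge0// -powRrM mulVf// powRr1 ?cmod_ge0//.
by rewrite cmodE -polar_form.
Qed.

Lemma croot_gt0 (R : realType) (n : nat) (x : R) :
  0 < x -> 0 < croot n x%:C.
Proof.
move=> x0.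
have modx : cmod x%:C = x.
  by apply: complexI; rewrite cmodE gtr0_norm// ltcR.
have argx : carg x%:C = 0.
  by rewrite /carg -ltcR in x0 *; rewrite gt_eqF// lexx modx divff ?acos1 ?gt_eqF -?ltcR.
rewrite /croot modx argx mul0r cexp_i cos0 sin0 -[(1 +i* 0)%C]/(1 : R[i]) mulr1.
by rewrite ltcR powR_gt0.
Qed.

(** Rotating w by the difference of the arguments puts it on the half-line of
    z, and the hypothesis on the cubes fixes the ratio of the moduli.  No
    condition z != 0 or w != 0 is needed because z and w vanish together. *)
Lemma rotation_to_cube_multiple (R : realType) (r z w : R[i]) :
  0 < r -> z ^+ 3 = (r * w) ^+ 3 ->
  cexp ('i%C * (carg z - carg w)%:C) * w = z / r.
Proof.
move=> r0 zw.
have normz : `|z| = r * `|w|.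
  rewrite -[r]gtr0_norm// -normrM; apply/eqP.
  by rewrite -(@eqrXn2 _ 3)// -!normrX zw.
rewrite [X in _ * X]polar_form mulrCA -cexp_iD subrK.
by rewrite [X in _ = X / r]polar_form normz mulrAC [r * _]mulrC mulfK ?gt_eqF.
Qed.

(** * Cardano's formula *)

(** As m^3 = -1, the number y = m U + m^2 V satisfies
    y^3 = - U^3 + V^3 - 3 U V y.  A factorization shows at once
    that these three numbers are roots and that there are no others. *)
Lemma Cardano (F : fieldType) (b c d s U V x : F) :
  2 != 0 :> F -> 3 != 0 :> F -> s ^+ 2 = -3 ->
  U ^+ 3 - V ^+ 3 = (2 * b ^+ 3 - 9 * c * b + 27 * d) / 27 ->
  3 * (U * V) = c - b ^+ 2 / 3 ->
  let y m := m * U + m ^+ 2 * V - b / 3 in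
  x ^+ 3 + b * x ^+ 2 + c * x + d =
  (x - y (-1)) * (x - y ((1 - s) / 2)) * (x - y ((1 + s) / 2)).
Proof.
move=> two0 three0 hs hcube hprod y; rewrite /y.
have n27 : 27 != 0 :> F by rewrite (_ : 27 = 3 ^+ 3) ?expf_neq0 //; ring.
(* Eliminating d and then c leaves an identity in b, s, U, V, x alone. *)
have -> : d = U ^+ 3 - V ^+ 3 - 2 * b ^+ 3 / 27 + c * b / 3.
  by rewrite hcube; field; rewrite n27 three0.
have -> : c = 3 * (U * V) + b ^+ 2 / 3 by rewrite hprod subrK.
by field: hs; rewrite ?n27 ?three0 ?two0.
Qed.

(** * The three identities behind the choice of cube roots *)

Section Identities.
Variables (R : realType) (b c d : R[i]).

Let D : R[i] := croot 2 (Delta_o b c d).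

Lemma sqrtN3_sqr : sqrtN3 R ^+ 2 = -3.
Proof. exact: crootK. Qed.

Lemma sqrt_Delta_o_sqr : D ^+ 2 = Delta_o b c d.
Proof. exact: crootK. Qed.

Lemma A_1_cube :
  A_1 b c d ^+ 3 * delta_l b c d = (4 * - d_o b c d * R_1 b c d) ^+ 3.
Proof.
rewrite [RHS]exprMn /R_1 crootK// /A_1 /delta_l.
move: sqrtN3_sqr sqrt_Delta_o_sqr; rewrite -/D /Delta_l /Delta_o /d_o.
move: (sqrtN3 R) (D) => s D' hs hD.
by field: hs hD; rewrite ?pnatr_eq0.
Qed.

Lemma A_2_cube :
  A_2 b c d ^+ 3 * delta_l b c d ^+ 2 =
  16 * (d_o b c d ^+ 2 * R_2 b c d) ^+ 3.
Proof.
rewrite exprMn /R_2 crootK// /A_2 /delta_l.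
move: sqrtN3_sqr sqrt_Delta_o_sqr; rewrite -/D /Delta_l /Delta_o /d_o.
move: (sqrtN3 R) (D) => s D' hs hD.
by field: hs hD; rewrite ?pnatr_eq0.
Qed.

Lemma A_1_A_2 :
  A_1 b c d * A_2 b c d * delta_l b c d =
  - (16 / 3) * d_o b c d ^+ 3 * (c - b ^+ 2 / 3).
Proof.
rewrite /A_1 /A_2 /delta_l.
move: sqrtN3_sqr sqrt_Delta_o_sqr; rewrite -/D /Delta_l /Delta_o /d_o.
move: (sqrtN3 R) (D) => s D' hs hD.
by field: hs hD; rewrite ?pnatr_eq0.
Qed.

Lemma R_1_cube_sub_R_2_cube :
  R_1 b c d ^+ 3 - R_2 b c d ^+ 3 =
  2 * ((2 * b ^+ 3 - 9 * c * b + 27 * d) / 27).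
Proof. by rewrite !crootK//; ring. Qed.

End Identities.

(** * Removing the arguments from the formula *)

Section Radicals.
Variables (R : realType) (b c d : R[i]).
Hypothesis d_o_neq0 : d_o b c d != 0.

Let k : R[i] := croot 3 4 / 2.
Let t : R[i] := croot 3 (delta_l b c d).

Lemma half_cbrt4_gt0 : 0 < k.
Proof.
rewrite divr_gt0// (_ : 4 = (4 : R)%:C) ?croot_gt0//.
by rewrite -(rmorph_nat (real_complex R)).
Qed.

Lemma half_cbrt4_cube : k ^+ 3 = 1 / 2.
Proof. by rewrite expr_div_n crootK//; field; rewrite ?pnatr_eq0. Qed.

(** Here and in [alpha_2_R_2] the arguments disappear, leaving expressions to
    which the polynomial identities apply. *)
Lemma alpha_1_R_1 :
  alpha_1 b c d * R_1 b c d = - (k * A_1 b c d * t) / (4 * d_o b c d).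
Proof.
have cubes : (A_1 b c d * t) ^+ 3 = (4 * (- d_o b c d * R_1 b c d)) ^+ 3.
  by rewrite exprMn crootK// A_1_cube mulrA.
have rot := rotation_to_cube_multiple _ _ _ _ (ltr0Sn _ 3) cubes.
rewrite /alpha_1 -/k -/t.
move: rot; move: (cexp _) => e rot.
apply: (@mulfI _ (- d_o b c d)); first by rewrite oppr_eq0.
rewrite [LHS](_ : _ = k * (e * (- d_o b c d * R_1 b c d))); last by ring.
by rewrite rot; field; rewrite ?d_o_neq0 ?pnatr_eq0.
Qed.

Lemma alpha_2_R_2 :
  alpha_2 b c d * R_2 b c d = A_2 b c d * t ^+ 2 / (4 * k * d_o b c d ^+ 2).
Proof.
have k0 : k != 0 by rewrite gt_eqF// half_cbrt4_gt0.
(* Since k^3 = 1 / 2, the positive cube root of 16 is 4 k^2. *)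
have r0 : 0 < 4 * k ^+ 2 by rewrite mulr_gt0// exprn_gt0// half_cbrt4_gt0.
have cubes : (A_2 b c d * t ^+ 2) ^+ 3 =
             (4 * k ^+ 2 * (d_o b c d ^+ 2 * R_2 b c d)) ^+ 3.
  rewrite exprMn exprAC crootK// A_2_cube [RHS]exprMn; congr (_ * _).
  rewrite exprMn exprAC half_cbrt4_cube.
  by field; rewrite ?pnatr_eq0.
have rot := rotation_to_cube_multiple _ _ _ _ r0 cubes.
rewrite /alpha_2 -/k -/t.
move: rot; move: (cexp _) => e rot.
apply: (@mulfI _ (d_o b c d ^+ 2)); first by rewrite expf_neq0.
rewrite [LHS](_ : _ = k * (e * (d_o b c d ^+ 2 * R_2 b c d))); last by ring.
by rewrite rot; field; rewrite ?d_o_neq0 ?k0 ?pnatr_eq0.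
Qed.

Lemma alpha_R_cubes :
  (alpha_1 b c d * R_1 b c d) ^+ 3 - (alpha_2 b c d * R_2 b c d) ^+ 3 =
  (2 * b ^+ 3 - 9 * c * b + 27 * d) / 27.
Proof.
have alpha1R1 : (alpha_1 b c d * R_1 b c d) ^+ 3 = R_1 b c d ^+ 3 / 2.
  rewrite alpha_1_R_1 expr_div_n.
  rewrite (_ : (- _) ^+ 3 = - k ^+ 3 * (A_1 b c d ^+ 3 * t ^+ 3)); last by ring.
  rewrite half_cbrt4_cube crootK// A_1_cube.
  by field; rewrite ?d_o_neq0 ?pnatr_eq0.
have alpha2R2 : (alpha_2 b c d * R_2 b c d) ^+ 3 = R_2 b c d ^+ 3 / 2.
  rewrite alpha_2_R_2.
  have k0 : k != 0 by rewrite gt_eqF// half_cbrt4_gt0.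
  transitivity (A_2 b c d ^+ 3 * (t ^+ 3) ^+ 2 / (64 * k ^+ 3 * d_o b c d ^+ 6)).
    by field; rewrite ?d_o_neq0 ?k0 ?pnatr_eq0.
  rewrite [t ^+ 3]crootK// A_2_cube half_cbrt4_cube.
  by field; rewrite ?d_o_neq0 ?pnatr_eq0.
rewrite alpha1R1 alpha2R2 -mulrBl R_1_cube_sub_R_2_cube.
by field; rewrite ?pnatr_eq0.
Qed.

Lemma alpha_R_product :
  3 * ((alpha_1 b c d * R_1 b c d) * (alpha_2 b c d * R_2 b c d)) =
  c - b ^+ 2 / 3.
Proof.
have k0 : k != 0 by rewrite gt_eqF// half_cbrt4_gt0.
rewrite alpha_1_R_1 alpha_2_R_2.
have -> : - (k * A_1 b c d * t) / (4 * d_o b c d) *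
    (A_2 b c d * t ^+ 2 / (4 * k * d_o b c d ^+ 2)) =
    - (A_1 b c d * A_2 b c d * t ^+ 3) / (16 * d_o b c d ^+ 3).
  by field; rewrite ?d_o_neq0 ?k0 ?pnatr_eq0.
rewrite crootK// A_1_A_2.
by field; rewrite ?d_o_neq0 ?pnatr_eq0.
Qed.

End Radicals.

Theorem theorem3p3 (R : realType) (b c d : R[i]) (hdo : d_o b c d != 0) :
  [set x : R[i] | x ^+ 3 + b * x ^+ 2 + c * x + d = 0] =
  [set cubic_sol b c d m | m in
     [set -1; (1 - sqrtN3 R) / 2; (1 + sqrtN3 R) / 2]].
Proof.
have factored x := Cardano _ b c d _ _ _ x (lt0r_neq0 (ltr0Sn _ 1))
  (lt0r_neq0 (ltr0Sn _ 2)) (sqrtN3_sqr R) (alpha_R_cubes _ _ _ _ hdo)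
  (alpha_R_product _ _ _ _ hdo).
have solE m : cubic_sol b c d m = m * (alpha_1 b c d * R_1 b c d)
    + m ^+ 2 * (alpha_2 b c d * R_2 b c d) - b / 3.
  by congr (_ + _ - _); rewrite mulrA.
apply/seteqP; split => x /=.
  rewrite factored -!solE => /eqP; rewrite !mulf_eq0 !subr_eq0.
  move=> /orP[/orP[]|] /eqP ->; (eexists; last reflexivity).
  - by left; left.
  - by left; right.
  - by right.
by move=> [m [[]|] -> <-]; rewrite factored -!solE subrr !(mul0r, mulr0).
Qed.
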